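(* Let $M,N$ be positive integers with $N>2M$, and let $g$ be a real $M\times M$ grayscale image with pixel values in $[0,255]$, zero-padded to an $N\times N$ array (nonzero only on the block $0\le n_1,n_2\le M-1$). Let $\tilde g=\tilde g_R+j\tilde g_I$ be its $N\times N$ 2D-DFT and let the two-bit samples be $\tilde X=\tilde X_R+j\tilde X_I$ with $\tilde X_R=\mathbb{1}(\tilde g_R+W_R+d_R>0)-\tfrac12$ and $\tilde X_I=\mathbb{1}(\tilde g_I+W_I+d_I>0)-\tfrac12$ entrywise. Let $\gamma\in(0,2/f_{\max})$, let $\mathcal Z$ be the map defined in the context, and let $\tilde G_{\text{two-bit}}$ be the fixed point of the recursion $\tilde G^{(0)}=0$, $\tilde G^{(k+1)}=\mathcal Z(\tilde G^{(k)})$ (the output of Algorithm 2 in the frequency domain). Then the expected mean squared error $\frac1{N^2}\mathbb E\big[\|\tilde G_{\text{two-bit}}-\tilde g\|_F^2\big]$ is $O(M^2/N^2)$, where the implied constant depends only on $\gamma$ and on $\alpha:=\|1-\gamma f\|_{\max}$.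
   Context: 2D-DFT: $\tilde g[k,l]=\sum_{n_1,n_2=0}^{N-1}g[n_1,n_2]e^{-j2\pi(kn_1+ln_2)/N}$, inverse $\mathfrak F^{-1}(\tilde g)[k,l]=\frac1{N^2}\sum_{n_1,n_2}\tilde g[n_1,n_2]e^{j2\pi(kn_1+ln_2)/N}$; $\mathfrak F$ denotes the 2D-DFT. Noise model: $W_R,W_I$ have independent entries, additive zero-mean with a known distribution symmetric about $0$; $d_R,d_I$ are independent AWGN dither (added when needed so that the total noise density is positive on the signal range). $\mathcal F$ is the CDF and $f$ the PDF of the total noise, applied entrywise; $f_{\max}$ is the maximum of $f$ over the region within the bounds of the signal and $\|1-\gamma f\|_{\max}$ the maximum of $|1-\gamma f(x)|$ over that region. Let $\mathbb S_c=\{a+jb: a,b\in[-255N^2,255N^2]\}$. The operator $\mathcal Q$ on complex $N\times N$ matrices is $\mathcal Q(\tilde h)=\mathfrak F(\textsc{Clip}(\textsc{Proj}(\mathfrak F^{-1}(\tilde h))))$, where $\textsc{Proj}$ sets to zero all spatial-domain pixels outside the support region (the $M^2$ pixels of the image block, i.e. all pixels except the zero-padding) and $\textsc{Clip}$ clips pixel values to the range $[0,255]$. The map $\mathcal Z:\mathbb S_c^{N\times N}\to\mathbb S_c^{N\times N}$ is $\mathcal Z(\tilde h)=\mathcal Q\big(\gamma(\tilde X_R+j\tilde X_I)+\tilde h-\gamma(\mathcal F(\tilde h_R)+j\mathcal F(\tilde h_I)-\tfrac{1+j}{2})\big)$, where $\tilde h_R,\tilde h_I$ are the real and imaginary parts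 of $\tilde h$. *)

(* Defs.v *)
From HB Require Import structures.
From mathcomp Require Import all_boot all_order all_algebra.
From mathcomp Require Import all_classical all_reals all_analysis.
From mathcomp.real_closed Require Import complex.

Set Implicit Arguments.
Unset Strict Implicit.
Unset Printing Implicit Defensive.

Import Order.TTheory GRing.Theory Num.Theory.

Local Open Scope ring_scope.
Local Open Scope complex_scope.

Section SignalDefs.
Context {R : realType}.

Definition expj (t : R) : R[i] := (cos t +i* sin t).

Definition dft2 (N : nat) (x : 'M[R[i]]_N) : 'M[R[i]]_N :=
  \matrix_(k, l) \sum_(n1 < N) \sum_(n2 < N)
     x n1 n2 * expj (- (2 * pi * ((k * n1 + l * n2)%N)%:R / N%:R)).

Definition idft2 (N : nat) (x : 'M[R[i]]_N) : 'M[R[i]]_N :=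
  \matrix_(k, l) (((N%:R ^+ 2)^-1)%:C * \sum_(n1 < N) \sum_(n2 < N)
     x n1 n2 * expj (2 * pi * ((k * n1 + l * n2)%N)%:R / N%:R)).

Definition in_block (N M : nat) (i j : 'I_N) : bool := (i < M)%N && (j < M)%N.

Definition proj_block (N M : nat) (x : 'M[R[i]]_N) : 'M[R[i]]_N :=
  \matrix_(i, j) (if in_block M i j then x i j else 0).

Definition clip255 (t : R) : R := Num.min (Num.max t 0) 255.

(* CLIP: clip pixel values to [0,255]; a pixel is a real grey value, so the
   (complex) spatial value is mapped to the clipped real part
   (= Euclidean projection of C onto the real segment [0,255]). *)
Definition clip_mx (N : nat) (x : 'M[R[i]]_N) : 'M[R[i]]_N :=
  \matrix_(i, j) (clip255 (complex.Re (x i j)))%:C.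

Definition Qop (N M : nat) (h : 'M[R[i]]_N) : 'M[R[i]]_N :=
  dft2 (clip_mx (proj_block M (idft2 h))).

Definition ReM (N : nat) (h : 'M[R[i]]_N) : 'M[R]_N := \matrix_(i, j) complex.Re (h i j).
Definition ImM (N : nat) (h : 'M[R[i]]_N) : 'M[R]_N := \matrix_(i, j) complex.Im (h i j).
Definition cplx_mx (N : nat) (A B : 'M[R]_N) : 'M[R[i]]_N :=
  \matrix_(i, j) (A i j +i* B i j).

Definition Zop (N M : nat) (gamma : R) (F : R -> R) (XR XI : 'M[R]_N)
    (h : 'M[R[i]]_N) : 'M[R[i]]_N :=
  Qop M (gamma%:C *: cplx_mx XR XI + h
         - gamma%:C *: (cplx_mx (map_mx F (ReM h)) (map_mx F (ImM h))
                        - const_mx ((1 +i* 1) / 2%:R))).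

Definition frob2 (N : nat) (x : 'M[R[i]]_N) : R :=
  \sum_(i < N) \sum_(j < N) (complex.Re (x i j) ^+ 2 + complex.Im (x i j) ^+ 2).

(* the signal range [-255 N^2, 255 N^2] (bounds of real/imag parts of S_c) *)
Definition in_range (N : nat) (x : R) : bool :=
  (- (255 * N%:R ^+ 2) <= x) && (x <= 255 * N%:R ^+ 2).

Definition sgn_bit (v : R) : R := (if 0 < v then 1 else 0) - 2%:R^-1.

End SignalDefs.

Local Open Scope classical_set_scope.
Definition mutually_independent {d} {T : measurableType d} {R : realType}
    (P : probability T R) (I : finType) (X : I -> T -> R) : Prop :=
  forall B : I -> set R, (forall i, measurable (B i)) ->
    P (\bigcap_(i in [set: I]) (X i @^-1` B i))
    = (\prod_(i : I) P (X i @^-1` B i))%E.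

Definition noise_family {d} {T : measurableType d} {R : realType} (N : nat)
    (WR WI dR dI : 'I_N -> 'I_N -> T -> R) : (bool * bool * 'I_N * 'I_N) -> T -> R :=
  fun '(b1, b2, k, l) =>
    (if b1 then (if b2 then dI else dR) else (if b2 then WI else WR)) k l.

(* Main.v *)
(* The unitary normalisation of the DFT makes Q non-expansive for the Frobenius
   norm, and h |-> h - gamma F(h) is alpha-Lipschitz entrywise on the signal
   range, so Z is an alpha-contraction there and
     |G - g~| <= |Z(g~) - g~| / (1 - alpha).
   Since g~ is fixed by Q, Z(g~) - g~ = Q(g~ + gamma E) - Q(g~) with the centred
   bits E = X - F(g~) + 1/2: only the M^2 pixels of the block survive the
   projection, and each coefficient of the inverse DFT of E has variance O(1/N^2)
   because the bits are pairwise independent.  They are centred because the total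
   noise is symmetric and atomless on the signal range, hence P(g~ + W + d > 0) = F(g~). *)

Require Import Defs.
From HB Require Import structures.
From mathcomp Require Import all_boot all_order all_algebra.
From mathcomp Require Import all_classical all_reals all_analysis.
From mathcomp.real_closed Require Import complex.
From mathcomp Require Import measurable_realfun ring lra.

Import Order.TTheory GRing.Theory Num.Theory.
Import numFieldNormedType.Exports.
Local Open Scope classical_set_scope.
Local Open Scope ring_scope.
Local Open Scope complex_scope.

Set Implicit Arguments.
Unset Strict Implicit.

(** * Discrete Fourier transform *)

Section Fourier.
Context {R : realType}.
Implicit Types (N M : nat) (s t : R).

(** The limit [G] is known only through [frob2 (iter n Z 0 - G)] tending to 0, so the error is
    bounded along the iterates and passed to the limit, without using [Z G = G]. The contraction
    needs both arguments in the signal range; the iterates stay there because [Qop] returns the DFT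
    of an image clipped to [0,255]. All estimates are on squared norms: weighted convexity of the
    square, with a weight midway between [alpha] and 1, leads to the constant 8; a further factor 2
    counts the real and imaginary bits. Centring the bits is the delicate point. The indicator
    behind a bit has mean P(V > -v), whereas F(v) = P(V <= v); symmetry identifies them only if V
    has no atom at -v. Since the density is bounded on the signal range only, atoms are excluded by
    a Lipschitz bound there, and by reflection at the left endpoint, which has no left neighbourhood
    in the range. Symmetry of W is given through its CDF, so it is lifted to all Borel sets before
    independence carries it over to W + d. *)

Lemma expjD s t : expj (s + t) = expj s * expj t :> R[i].
Proof.
by rewrite /expj cosD sinD; simpc; congr (_ +i* _); rewrite addrC [X in X + _]mulrC.
Qed.

Lemma expj0 : expj 0 = 1 :> R[i].
Proof. by rewrite /expj cos0 sin0. Qed.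

Lemma expjX t n : expj (t *+ n) = expj t ^+ n :> R[i].
Proof. by elim: n => [|n IH]; rewrite ?mulr0n ?expj0// mulrS expjD IH exprS. Qed.

Lemma conjc_expj t : conjc (expj t) = expj (- t).
Proof. by rewrite /expj cosN sinN. Qed.

(** If cos t = 1, the double angle formula forces sin (t/2) = 0, impossible for 0 < |t/2| < pi. *)
Lemma expj_neq1 t : t != 0 -> `|t| < 2 * pi -> expj t != 1 :> R[i].
Proof.
move=> t0 ltpi; apply/eqP => -[ct _].
have tE : t = t / 2 + t / 2 by field.
have : sin (t / 2) == 0.
  rewrite -sqrf_eq0; apply/eqP.
  have := cos2Dsin2 (t / 2); have : cos (t / 2 + t / 2) = 1 by rewrite -tE.
  by rewrite cosD -!expr2 => ? ?; lra.
wlog tp : t t0 ltpi {ct tE} / 0 < t => [wl|].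
  have [/(wl _ t0 ltpi)//|tn|/eqP tz] := ltgtP 0 t; last by rewrite eq_sym (negbTE t0) in tz.
  by rewrite -oppr_eq0 -sinN -mulNr; apply: wl; rewrite ?oppr_eq0 ?normrN ?oppr_gt0.
rewrite gt_eqF// sin_gt0_pi//; move: ltpi; rewrite gtr0_norm// => ?; lra.
Qed.

(** The sign [t] selects the forward (-1) or inverse (1) kernel. The matrix is symmetric, so a 2D
    transform multiplies by the same matrix on both sides. *)
Definition dft_mx N t : 'M[R[i]]_N :=
  \matrix_(k, n) expj (t * (2 * pi * (k * n)%:R / N%:R)).

Lemma dft_mx_tr N t : (dft_mx N t)^T = dft_mx N t.
Proof. by apply/matrixP => k l; rewrite !mxE mulnC. Qed.

Lemma conjc_dft_mx N t : map_mx conjc (dft_mx N t) = dft_mx N (- t).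
Proof. by apply/matrixP => k l; rewrite !mxE conjc_expj mulNr. Qed.

Lemma dft_mx_mul1 N : dft_mx N 1 *m dft_mx N (- 1) = (N%:R)%:M.
Proof.
apply/matrixP => k l; rewrite !mxE.
have N0 : N%:R != 0 :> R by rewrite pnatr_eq0 -lt0n; case: N k {l} => // -[].
pose z : R[i] := expj (2 * pi * (k%:R - l%:R) / N%:R).
transitivity (\sum_(n < N) z ^+ n).
  apply: eq_bigr => n _; rewrite !mxE -expjD -expjX; congr expj.
  by rewrite !natrM -mulr_natr; field.
have [ekl|kl] := eqVneq k l.
  rewrite (eq_bigr (fun=> 1)) ?sumr_const ?card_ord// => n _.
  by rewrite /z ekl subrr mulr0 mul0r expj0 expr1n.
have zN : z ^+ N = 1.
  rewrite -expjX -[X in expj X]mulr_natr mulfVK//.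
  have e2 : expj (2 * pi) = 1 :> R[i].
    by rewrite /expj mulr_natl cos2pi mulr2n sinDpi sinpi oppr0.
  have [lk|lk] := leqP l k.
    by rewrite -natrB// mulr_natr expjX e2 expr1n.
  rewrite -opprB -natrB 1?ltnW// mulrN mulr_natr -conjc_expj expjX e2 expr1n.
  by rewrite /= oppr0.
have z1 : z != 1.
  have Np : 0 < N%:R :> R by rewrite lt0r N0 ler0n.
  apply: expj_neq1.
    rewrite !mulf_neq0 ?invr_neq0//; first by rewrite gt_eqF ?pi_gt0.
    by rewrite subr_eq0 eqr_nat; apply: contraNN kl => /eqP/val_inj->.
  rewrite -mulrA normrM gtr0_norm ?mulr_gt0 ?pi_gt0//.
  rewrite gtr_pMr ?mulr_gt0 ?pi_gt0// normrM normfV (gtr0_norm Np).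
  rewrite ltr_pdivrMr// mul1r.
  have := ltn_ord k; have := ltn_ord l; rewrite -!(ltr_nat R) => ? ?.
  have := ler0n R k; have := ler0n R l => ? ?.
  by rewrite ltr_norml; apply/andP; split; lra.
apply: (mulfI (_ : z - 1 != 0)); first by rewrite subr_eq0.
by rewrite -subrX1 zN subrr mulr0n mulr0.
Qed.

Definition is_sign t := (t == 1) || (t == - 1).

Lemma dft_mx_mul N t : is_sign t -> dft_mx N t *m dft_mx N (- t) = (N%:R)%:M.
Proof.
case/orP => /eqP ->; first exact: dft_mx_mul1.
rewrite opprK -[LHS]trmxK trmx_mul !dft_mx_tr dft_mx_mul1.
exact: tr_scalar_mx.
Qed.

Lemma dft2E N (x : 'M[R[i]]_N) :
  dft2 x = dft_mx N (- 1) *m x *m dft_mx N (- 1).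
Proof.
apply/matrixP => k l; rewrite !mxE exchange_big; apply: eq_bigr => n2 _.
rewrite !mxE big_distrl; apply: eq_bigr => n1 _ /=.
rewrite !mxE (mulrC (expj _) (x _ _)) -(mulrA (x _ _)) -expjD; congr (_ * expj _).
by rewrite natrD (mulnC n2) !natrM; ring.
Qed.

Lemma idft2E N (x : 'M[R[i]]_N) :
  idft2 x = ((N%:R ^+ 2)^-1)%:C *: (dft_mx N 1 *m x *m dft_mx N 1).
Proof.
apply/matrixP => k l; rewrite !mxE; congr (_ * _).
rewrite exchange_big; apply: eq_bigr => n2 _.
rewrite !mxE big_distrl; apply: eq_bigr => n1 _ /=.
rewrite !mxE (mulrC (expj _) (x _ _)) -(mulrA (x _ _)) -expjD; congr (_ * expj _).
by rewrite natrD (mulnC n2) !natrM; ring.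
Qed.

Lemma dft2B N (x y : 'M[R[i]]_N) : dft2 (x - y) = dft2 x - dft2 y.
Proof. by rewrite !dft2E mulmxBr mulmxBl. Qed.

Lemma idft2B N (x y : 'M[R[i]]_N) : idft2 (x - y) = idft2 x - idft2 y.
Proof. by rewrite !idft2E mulmxBr mulmxBl scalerBr. Qed.

Lemma dft2K N (x : 'M[R[i]]_N) : idft2 (dft2 x) = x.
Proof.
case: N x => [|N] x; first by apply/matrixP => -[].
have := dft_mx_mul N.+1 (t := - 1); rewrite opprK /is_sign eqxx orbT => /(_ isT) e.
rewrite idft2E dft2E !mulmxA dft_mx_mul1 -mulmxA e mul_scalar_mx mul_mx_scalar.
rewrite !scalerA (_ : _ * _ = 1) ?scale1r// -(rmorph_nat (real_complex R)) /=.
rewrite -!rmorphM -[RHS](rmorph1 (real_complex R)) /=; congr (_%:C).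
have : N.+1%:R != 0 :> R by rewrite pnatr_eq0.
by move: (N.+1%:R) => c c0; field.
Qed.

Lemma frob2_trace N (x : 'M[R[i]]_N) :
  (frob2 x)%:C = \tr (x *m (map_mx conjc x)^T).
Proof.
rewrite /frob2 rmorph_sum; apply: eq_bigr => i _.
rewrite rmorph_sum !mxE; apply: eq_bigr => j _; rewrite !mxE.
case: (x i j) => a b /=; simpc; congr (_ +i* _); ring.
Qed.

(** Parseval through the trace: the inner kernels cancel directly, the outer ones by cyclicity, and
    each pair leaves a factor N. *)
Lemma frob2_dft_mx N t (x : 'M[R[i]]_N) : is_sign t ->
  frob2 (dft_mx N t *m x *m dft_mx N t) = N%:R ^+ 2 * frob2 x.
Proof.
move=> st; apply: (fmorph_inj (real_complex R)) => /=.
rewrite rmorphM rmorphXn rmorph_nat /= !frob2_trace !map_mxM conjc_dft_mx.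
have e : dft_mx N (- t) *m dft_mx N t = (N%:R)%:M.
  rewrite -{2}(opprK t) dft_mx_mul//.
  by move: st; rewrite /is_sign orbC eqr_opp eqr_oppLR.
rewrite !trmx_mul !dft_mx_tr !mulmxA -(mulmxA _ (dft_mx N t) (dft_mx N (- t))).
rewrite dft_mx_mul// mul_mx_scalar -!scalemxAl linearZ /= mxtrace_mulC !mulmxA e.
by rewrite mul_scalar_mx -scalemxAl linearZ /= mulrA expr2.
Qed.

Lemma frob2_ge0 N (x : 'M[R[i]]_N) : 0 <= frob2 x.
Proof. by do 2!apply: sumr_ge0 => ? _; rewrite addr_ge0 ?sqr_ge0. Qed.

Lemma frob2Z N (c : R) (x : 'M[R[i]]_N) : frob2 (c%:C *: x) = c ^+ 2 * frob2 x.
Proof.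
rewrite /frob2 mulr_sumr; apply: eq_bigr => i _; rewrite mulr_sumr.
by apply: eq_bigr => j _; rewrite !mxE; case: (x i j) => a b /=; ring.
Qed.

Lemma frob2_dft2 N (x : 'M[R[i]]_N) : frob2 (dft2 x) = N%:R ^+ 2 * frob2 x.
Proof. by rewrite dft2E frob2_dft_mx// /is_sign eqxx orbT. Qed.

Lemma frob2_idft2 N (x : 'M[R[i]]_N) : frob2 (idft2 x) = (N%:R ^+ 2)^-1 * frob2 x.
Proof.
case: N x => [|N] x; first by rewrite /frob2 !big_ord0 mulr0.
rewrite idft2E frob2Z frob2_dft_mx ?/is_sign ?eqxx//.
by rewrite [X in X * _]expr2 -mulrA mulKf// sqrf_eq0 pnatr_eq0.
Qed.

Lemma clip255_sqr_le (a b : R) : (clip255 a - clip255 b) ^+ 2 <= (a - b) ^+ 2.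
Proof.
wlog ba : a b / b <= a => [wl|].
  by have [/wl//|/ltW/wl] := leP b a; rewrite -sqrrN opprB -[leRHS]sqrrN opprB.
suff /andP[? ?] : 0 <= clip255 a - clip255 b <= a - b by rewrite ler_sqr ?nnegrE ?(subr_ge0 b).
rewrite /clip255 !minElt !maxElt.
have h : 0 < 255 :> R by lra.
case: (ltP a 0) => ?; case: (ltP b 0) => ?; rewrite ?h ?subrr ?subr_ge0 ?lexx//.
- lra.
- by case: (ltP a 255) => ?; apply/andP; split; lra.
- by case: (ltP a 255) => ?; case: (ltP b 255) => ?; apply/andP; split; lra.
Qed.

Lemma clip255_id (a : R) : 0 <= a <= 255 -> clip255 a = a.
Proof. by move=> /andP[a0 a1]; rewrite /clip255 max_l// min_l. Qed.

Lemma clip255_itv (a : R) : 0 <= clip255 a <= 255.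
Proof. by rewrite /clip255 le_min le_max lexx orbT /= ge_min lexx orbT andbT; lra. Qed.

Lemma frob2_clip_proj N M (x y : 'M[R[i]]_N) :
  frob2 (clip_mx (proj_block M x) - clip_mx (proj_block M y)) <=
  \sum_(i < N) \sum_(j < N | in_block M i j) complex.Re (x i j - y i j) ^+ 2.
Proof.
apply: ler_sum => i _; rewrite [leRHS]big_mkcond /=; apply: ler_sum => j _.
rewrite !mxE /=; case: ifP => _ /=; last by rewrite !subrr expr0n addr0.
by rewrite oppr0 addr0 expr0n addr0 raddfB clip255_sqr_le.
Qed.

(** Enlarging the sum to all pixels yields non-expansiveness; keeping it on the block is the source
    of the factor M^2 in the final rate. *)
Lemma frob2_Qop N M (x y : 'M[R[i]]_N) : frob2 (Qop M x - Qop M y) <=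
  N%:R ^+ 2 * \sum_(i < N) \sum_(j < N | in_block M i j)
                 complex.Re (idft2 (x - y) i j) ^+ 2.
Proof.
rewrite -dft2B frob2_dft2 ler_wpM2l ?sqr_ge0//.
apply: le_trans (frob2_clip_proj M _ _) _; rewrite le_eqVlt; apply/orP; left.
by apply/eqP; do 2!apply: eq_bigr => ? _; rewrite idft2B !mxE.
Qed.

Lemma Qop_nonexpansive N M (x y : 'M[R[i]]_N) :
  frob2 (Qop M x - Qop M y) <= frob2 (x - y).
Proof.
case: N x y => [|N] x y; first by rewrite /frob2 !big_ord0.
apply: le_trans (frob2_Qop M _ _) _.
rewrite -[leRHS](mulVKf (_ : N.+1%:R ^+ 2 != 0)) ?sqrf_eq0 ?pnatr_eq0//.
rewrite ler_wpM2l ?sqr_ge0// -frob2_idft2.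
apply: ler_sum => i _; rewrite big_mkcond /=; apply: ler_sum => j _.
by case: ifP => _; rewrite ?lerDl ?addr_ge0 ?sqr_ge0.
Qed.

Lemma Qop_dft2_id N M (g : 'M[R]_N) :
  (forall i j : 'I_N, in_block M i j -> 0 <= g i j <= 255) ->
  (forall i j : 'I_N, ~~ in_block M i j -> g i j = 0) ->
  Qop M (dft2 (map_mx (real_complex R) g)) = dft2 (map_mx (real_complex R) g).
Proof.
move=> g255 g0; rewrite /Qop dft2K; congr dft2.
apply/matrixP => i j; rewrite !mxE.
case: ifPn => [bij|/g0->]; first by rewrite clip255_id ?g255.
by rewrite clip255_id ?lexx ?ler0n.
Qed.

Lemma dft2_in_range N (x : 'M[R]_N) (k l : 'I_N) :
  (forall i j, 0 <= x i j <= 255) ->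
  in_range N (complex.Re (dft2 (map_mx (real_complex R) x) k l)) /\
  in_range N (complex.Im (dft2 (map_mx (real_complex R) x) k l)).
Proof.
move=> x255.
have bound (c : R -> R) : (forall t, `|c t| <= 1) -> forall t : 'I_N -> 'I_N -> R,
    in_range N (\sum_(i < N) \sum_(j < N) x i j * c (t i j)).
  move=> c1 t; rewrite /in_range -ler_norml.
  apply: (@le_trans _ _ (\sum_(i < N) \sum_(j < N) 255)); last first.
    by rewrite !sumr_const !card_ord -mulrnA -[X in X <= _]mulr_natr natrM expr2.
  apply: le_trans (ler_norm_sum _ _ _) _; apply: ler_sum => i _.
  apply: le_trans (ler_norm_sum _ _ _) _; apply: ler_sum => j _.
  have /andP[? ?] := x255 i j.
  by rewrite normrM ger0_norm// (le_trans (ler_piMr _ (c1 _))).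
by rewrite mxE !raddf_sum; split;
   under eq_bigr do rewrite raddf_sum;
   under eq_bigr do under eq_bigr do rewrite !mxE /= mul0r ?subr0 ?addr0;
   apply: bound => t; rewrite ler_norml ?cos_geN1 ?cos_le1 ?sin_geN1 ?sin_le1.
Qed.

(** Keeps the iterates in the region where the bounds on the noise density are available. *)
Lemma Qop_in_range N M (h : 'M[R[i]]_N) k l :
  in_range N (complex.Re (Qop M h k l)) /\ in_range N (complex.Im (Qop M h k l)).
Proof.
pose x := \matrix_(i, j) clip255 (complex.Re (proj_block M (idft2 h) i j)).
have -> : Qop M h = dft2 (map_mx (real_complex R) x).
  by congr dft2; apply/matrixP => i j; rewrite !mxE.
by apply: dft2_in_range => i j; rewrite mxE clip255_itv.
Qed.

End Fourier.

(** * Integration and probability *)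

(* The density f of the statement is not assumed measurable.  The integral of a
   nonnegative function is the supremum of the integrals of the simple functions
   below it, so the comparisons needed on F hold for arbitrary f; the same goes
   for the expectation of the error, as nothing is assumed on G. *)
Section IntegralWithoutMeasurability.
Context d (T : measurableType d) (R : realType).
Variable mu : {measure set T -> \bar R}.
Implicit Types (f g : T -> R) (h : {nnsfun T >-> R}) (D A : set T).
Import HBNNSimple.
Local Open Scope ereal_scope.

Lemma sintegral_le_integral D f h : (forall x, 0 <= f x)%R ->
  (forall x, (h x <= (f \_ D) x)%R) -> sintegral mu h <= \int[mu]_(x in D) (f x)%:E.
Proof.
move=> f0 hf; rewrite ge0_integralE => [|x _]; last by rewrite lee_fin.
apply: ereal_sup_ubound; exists h => //= x.
by have := hf x; rewrite !patchE; case: ifP => _; rewrite lee_fin.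
Qed.

Lemma integral_le_sintegral D f b : (forall x, 0 <= f x)%R ->
  (forall h, (forall x, (h x <= (f \_ D) x)%R) -> sintegral mu h <= b) ->
  \int[mu]_(x in D) (f x)%:E <= b.
Proof.
move=> f0 hb; rewrite ge0_integralE => [|x _]; last by rewrite lee_fin.
apply: ge_ereal_sup => _ [h /= hf <-]; apply: hb => x.
by have := hf x; rewrite !patchE; case: ifP => _; rewrite lee_fin.
Qed.

Lemma le_integral_nonmeasurable f g : (forall x, 0 <= f x)%R ->
  (forall x, f x <= g x)%R -> \int[mu]_x (f x)%:E <= \int[mu]_x (g x)%:E.
Proof.
move=> f0 fg; apply: integral_le_sintegral => // h hf.
apply: sintegral_le_integral => x; first exact: le_trans (fg x).
by have := hf x; rewrite !patchE in_setT => /le_trans; apply.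
Qed.

Lemma sintegralD_cst A h (c : {nonneg R}) (mA : measurable A) :
  sintegral mu (add_nnsfun h (scale_nnsfun (indic_nnsfun R mA) (ge0 c))) =
  sintegral mu h + c%:num%:E * mu A.
Proof.
by rewrite sintegralD sintegralrM sintegral_indic.
Qed.

(** If a simple [h] lies below f on D, then [h] plus c times the indicator of A is simple and lies
    below f on the union. *)
Lemma integral_setU_ge_cst D A f (c : R) : (forall x, 0 <= f x)%R -> measurable A ->
  D `&` A = set0 -> (0 <= c)%R -> (forall x, A x -> c <= f x)%R ->
  mu A \is a fin_num -> 
  \int[mu]_(x in D) (f x)%:E + c%:E * mu A <= \int[mu]_(x in D `|` A) (f x)%:E.
Proof.
move=> f0 mA DA c0 cf muA; rewrite -leeBrDr ?fin_numM//.
apply: integral_le_sintegral => // h hf; rewrite leeBrDr ?fin_numM//.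
rewrite -[c]/((NngNum c0)%:num) -(sintegralD_cst _ _ mA).
apply: sintegral_le_integral => // x /=.
have := hf x; rewrite !patchE in_setU mindicE.
have [xD|xD] := boolP (x \in D); have [xA|xA] := boolP (x \in A) => /=.
- have : (D `&` A) x by split; exact: set_mem.
  by rewrite DA.
- by rewrite mulr0 addr0.
- move=> hx; rewrite mulr1 (le_trans (lerD hx (lexx c)))// add0r cf//.
  exact: set_mem.
- by rewrite mulr0 addr0.
Qed.

(** Dually, a simple function below f on the union is dominated by its restriction to D plus c times
    the indicator of A. *)
Lemma integral_setU_le_cst D A f (c : R) : (forall x, 0 <= f x)%R ->
  measurable D -> measurable A ->
  D `&` A = set0 -> (0 <= c)%R -> (forall x, A x -> f x <= c)%R ->
  \int[mu]_(x in D `|` A) (f x)%:E <= \int[mu]_(x in D) (f x)%:E + c%:E * mu A.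
Proof.
move=> f0 mD mA DA c0 cf; apply: integral_le_sintegral => // h hf.
apply: (@le_trans _ _ (sintegral mu (proj_nnsfun h mD) + c%:E * mu A)); last first.
  rewrite leeD2r//; apply: sintegral_le_integral => // x.
  have := hf x; rewrite !patchE in_setU /= mindicE.
  by have [xD|xD] := boolP (x \in D) => /=; rewrite ?mulr1 ?mulr0.
rewrite -[c]/((NngNum c0)%:num) -(sintegralD_cst _ _ mA).
apply: le_sintegral => x /=.
have := hf x; rewrite !patchE in_setU /= !mindicE.
have [xD|xD] := boolP (x \in D); have [xA|xA] := boolP (x \in A) => /=;
  rewrite ?mulr1 ?mulr0 ?addr0 ?add0r//.
- by rewrite lerDl.
- by move/le_trans; apply; apply: cf; rewrite -inE.
Qed.

End IntegralWithoutMeasurability.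

(** * Increments of the distribution function *)

Section Cdf.
Context {R : realType}.
Variables (F f : R -> R).
Hypothesis f_ge0 : forall x, 0 <= f x.
Hypothesis F_int :
  forall x, (F x)%:E = (\int[lebesgue_measure]_(t in `]-oo, x]) (f t)%:E)%E.

Let itvU (x y : R) : x <= y ->
  `]-oo, y]%classic = `]-oo, x]%classic `|` `]x, y]%classic :> set R.
Proof. by move=> xy; rewrite (@itv_bndbnd_setU _ _ _ (BRight x)). Qed.

Let itvI (x y : R) : `]-oo, x]%classic `&` `]x, y]%classic = set0 :> set R.
Proof.
apply/seteqP; split=> // t [] /=; rewrite !in_itv /= => tx /andP[xt _].
by move: (lt_le_trans xt tx); rewrite ltxx.
Qed.

Let mu_itv (x y : R) : x <= y ->
  lebesgue_measure (`]x, y]%classic : set R) = (y - x)%:E.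
Proof.
rewrite le_eqVlt => /predU1P[->|xy]; rewrite lebesgue_measure_itv /= lte_fin.
  by rewrite ltxx subrr.
by rewrite xy EFinB.
Qed.

(** This and its upper counterpart replace the mean value theorem, since [F] need not be
    differentiable with derivative [f]. *)
Lemma cdf_increment_ge (c x y : R) : x <= y -> 0 <= c ->
  (forall t, x < t <= y -> c <= f t) -> c * (y - x) <= F y - F x.
Proof.
move=> xy c0 cf; rewrite lerBrDl -lee_fin EFinD EFinM F_int F_int (itvU xy) -mu_itv//.
apply: integral_setU_ge_cst => //.
suff : lebesgue_measure (`]x, y]%classic : set R) \is a fin_num by [].
by rewrite mu_itv.
Qed.

Lemma cdf_increment_le (c x y : R) : x <= y -> 0 <= c ->
  (forall t, x < t <= y -> f t <= c) -> F y - F x <= c * (y - x).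
Proof.
move=> xy c0 cf; rewrite lerBlDl -lee_fin EFinD EFinM F_int F_int (itvU xy) -mu_itv//.
exact: integral_setU_le_cst.
Qed.

End Cdf.

(** * Second moments of sums of bounded uncorrelated variables *)

Section Uncorrelated.
Context d (T : measurableType d) (R : realType) (P : probability T R).

Lemma bounded_Lfun1 (f : T -> R) (c : R) : measurable_fun setT f ->
  (forall w, `|f w| <= c) -> P.-integrable setT (EFin \o f).
Proof.
move=> mf fc; apply: measurable_bounded_integrable => //.
  by apply: (le_lt_trans (probability_le1 P _)); rewrite ?ltry.
exists c; split; rewrite ?num_real// => M cM w _ /=.
exact: le_trans (fc w) (ltW cM).
Qed.

(** Expanding the square leaves only the diagonal terms, each at most 1: the bound grows like the
    number of variables, not its square. *)
Lemma expectation_sqr_sum_uncorrelated (I : finType) (Y : I -> T -> R) (c : I -> R) :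
  (forall i, measurable_fun setT (Y i)) ->
  (forall i w, `|Y i w| <= 1) -> (forall i, `|c i| <= 1) ->
  (forall i j, i != j -> 'E_P[Y i \* Y j]%E = 0%E) ->
  (\int[P]_w ((\sum_i c i * Y i w) ^+ 2)%:E <= #|I|%:R%:E)%E.
Proof.
move=> mY Y1 c1 Y0.
have YY1 i j w : `|Y i w * Y j w| <= 1 by rewrite normrM mulr_ile1.
have mYY i j : measurable_fun setT (Y i \* Y j) by exact: measurable_funM.
have -> : (\int[P]_w ((\sum_i c i * Y i w) ^+ 2)%:E =
    \int[P]_w \sum_(p : I * I) (((c p.1 * c p.2) * (Y p.1 w * Y p.2 w))%:E))%E.
  apply: eq_integral => w _; rewrite sumEFin; congr EFin.
  rewrite expr2 big_distrlr pair_big /=; apply: eq_bigr => p _; exact: mulrACA.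
rewrite integral_sum //; last first.
  move=> p; apply: (@bounded_Lfun1 (fun w => c p.1 * c p.2 * (Y p.1 w * Y p.2 w)) 1).
    by apply: measurable_funM => //; exact: mYY.
  by move=> w; rewrite normrM mulr_ile1// normrM mulr_ile1.
rewrite -(pair_bigA _ (fun i j => \int[P]_w (c i * c j * (Y i w * Y j w))%:E)%E) /=.
have -> : #|I|%:R%:E = (\sum_(i : I) 1%:E)%E :> \bar R.
  by rewrite sumEFin sumr_const.
apply: lee_sum => i _; rewrite (bigD1 i)//= big1 => [|j ji]; rewrite ?adde0.
  apply: (@le_trans _ _ (\int[P]_w (cst 1%E w))%E); last first.
    by rewrite integral_cst//= mul1e probability_le1.
  apply: ge0_le_integral => //.
  - by move=> w _; rewrite lee_fin -!expr2 mulr_ge0 ?sqr_ge0.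
  - by apply/measurable_EFinP; apply: measurable_funM => //; exact: mYY.
  - move=> w _; rewrite lee_fin (le_trans (ler_norm _))//.
    by rewrite normrM mulr_ile1// normrM mulr_ile1.
rewrite (eq_integral (fun w => (c i * c j)%:E * (Y i w * Y j w)%:E)%E) => [|w _];
  last by rewrite EFinM.
rewrite integralZl//; last first.
  by apply: (@bounded_Lfun1 (Y i \* Y j) 1); [exact: mYY|exact: YY1].
by have := Y0 i j; rewrite eq_sym ji unlock => ->//; rewrite mule0.
Qed.

(** The expectation is the covariance of the two indicators, P(A and B) - P(A) P(B). *)
Lemma expectation_indic_centered (A B : set T) (p q : R) :
  measurable A -> measurable B -> P A = p%:E -> P B = q%:E ->
  P (A `&` B) = (P A * P B)%E ->
  ('E_P[(fun w => (\1_A w - p)%R) \* (fun w => (\1_B w - q)%R)] = 0)%E.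
Proof.
move=> mA mB pA qB PAB.
have indL (C : set T) : measurable C -> (\1_C : T -> R) \in Lfun P 1%E.
  move=> mC; apply/Lfun1_integrable; apply: (@bounded_Lfun1 _ 1) => // w.
  by rewrite indicE ger0_norm ?ler0n// lern1 leq_b1.
have := @covarianceE _ _ _ P \1_A \1_B (indL _ mA) (indL _ mB).
have -> : \1_A * \1_B = \1_(A `&` B) :> (T -> R) by rewrite indicI.
move=> /(_ (indL _ (measurableI _ _ mA mB))).
rewrite !expectation_indic ?PAB//; last exact: measurableI.
rewrite subee ?fin_numM ?fin_num_measure// => <-.
by rewrite covariance.unlock !expectation_indic// pA qB.
Qed.

End Uncorrelated.

(** * Uniqueness of finite measures from generating pi-systems *)

Section MeasureUniqueness.
Context {R : realType}.

Lemma measure_eq_rays (m1 m2 : {measure set R -> \bar R}) :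
  (forall x, m1 `]x, +oo[%classic = m2 `]x, +oo[%classic) ->
  (forall x, (m1 `]x, +oo[%classic < +oo)%E) ->
  forall A, measurable A -> m1 A = m2 A.
Proof.
move=> m12 m1oo A mA.
apply: (measure_unique (@RGenOInfty.G R) (fun k => `]- k%:R, +oo[%classic)) => //.
- exact: RGenOInfty.measurableE.
- move=> _ _ [x ->] [y ->]; exists (Num.max x y).
  by apply/seteqP; split=> z /=; rewrite !in_itv/= !andbT gt_max => /andP.
- by move=> k; exists (- k%:R).
- apply/seteqP; split=> // x _; exists (Num.truncn `|x|).+1 => //=.
  rewrite in_itv/= andbT ltrNl; apply: le_lt_trans (truncnS_gt _).
  by rewrite -normrN ler_norm.
- by move=> _ [x ->].
Qed.

(** Serves twice: to compare the laws of (X, Y) and (-X, -Y), and to extend independence from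
    rectangles to Borel sets of the plane. *)
Lemma measure_eq_rectangles d1 d2 (T1 : measurableType d1) (T2 : measurableType d2)
    (m1 m2 : {measure set (T1 * T2) -> \bar R}) :
  (forall A B, measurable A -> measurable B -> m1 (A `*` B) = m2 (A `*` B)) ->
  (m1 setT < +oo)%E ->
  forall C, measurable C -> m1 C = m2 C.
Proof.
move=> m12 m1oo C mC.
pose G := [set A `*` B | A in @measurable _ T1 & B in @measurable _ T2].
apply: (measure_unique G (fun=> setT)) => //.
- by rewrite measurable_prod_measurableType.
- move=> _ _ [A mA [B mB <-]] [A' mA' [B' mB' <-]].
  exists (A `&` A'); first exact: measurableI.
  by exists (B `&` B'); [exact: measurableI|rewrite setXI].
- by move=> _; exists setT => //; exists setT => //; rewrite setXTT.
- by rewrite bigcup_const.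
- by move=> _ [A mA [B mB <-]]; exact: m12.
Qed.

End MeasureUniqueness.

(** * Symmetric laws and centring of the bits *)

Section Symmetry.
Context d (T : measurableType d) (R : realType) (P : probability T R).
Implicit Types (X Y : T -> R).

Definition symmetric_law X := forall A : set R, measurable A ->
  P (X @^-1` A) = P ((\- X) @^-1` A).

(** Complements of the events in the CDF are right rays, a pi-system generating the Borel sets. *)
Lemma symmetric_law_cdf X : measurable_fun setT X ->
  (forall x, P [set w | X w <= x] = P [set w | - X w <= x]) -> symmetric_law X.
Proof.
move=> mX cdfX A mA.
have mNX : measurable_fun setT (\- X) by exact: measurable_funN.
pose X' : {mfun T >-> R} := HB.pack X (isMeasurableFun.Build _ _ _ _ X mX).
pose NX' : {mfun T >-> R} := HB.pack (\- X) (isMeasurableFun.Build _ _ _ _ (\- X) mNX).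
apply: (@measure_eq_rays _ (distribution P X') (distribution P NX')) => // x; last first.
  by rewrite (le_lt_trans (probability_le1 _ _))// ltry.
have E (Y : {mfun T >-> R}) : P (Y @^-1` `]x, +oo[) = (1 - P [set w | (Y w <= x)%R])%E.
  rewrite -probability_setC; last first.
    by rewrite -[X in measurable X]setTI; exact: measurable_fun_le.
  congr (P _); apply/seteqP; split=> w /=; rewrite in_itv/= andbT.
    by rewrite ltNge => /negP.
  by move/negP; rewrite -ltNge.
rewrite -[LHS]/(P (X' @^-1` `]x, +oo[%classic)).
by rewrite -[RHS]/(P (NX' @^-1` `]x, +oo[%classic)) !E/= cdfX.
Qed.

Lemma lebesgue_measure_opp (A : set R) : measurable A ->
  lebesgue_measure (-%R @^-1` A) = lebesgue_measure A :> \bar R.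
Proof.
move=> mA; have mN : measurable_fun setT (-%R : R -> R) by exact: oppr_measurable.
pose N : {mfun (measurableTypeR R) >-> (measurableTypeR R)} :=
  HB.pack (-%R : R -> R)
    (isMeasurableFun.Build _ _ _ _ (-%R : measurableTypeR R -> measurableTypeR R) mN).
symmetry; apply: (@lebesgue_measure_unique R (pushforward (@lebesgue_measure R) N)) => //.
move=> _ [[a b] _ <-] /=.
(* Reflection turns ]a, b] into an interval closed on the other side, of the same length. *)
transitivity (lebesgue_measure (`[- b, - a[%classic : set R)); last first.
  by congr lebesgue_measure; apply/seteqP; split=> x /=;
    rewrite !in_itv/= lerNl ltrNr andbC.
by rewrite !lebesgue_measure_itv /= !lte_fin ltrN2 -!EFinB opprK addrC.
Qed.

Lemma normal_prob_opp (s : R) (A : set R) : s != 0 -> measurable A ->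
  normal_prob 0 s (-%R @^-1` A) = normal_prob 0 s A.
Proof.
move=> s0 mA; have mN : measurable_fun setT (-%R : R -> R) by exact: oppr_measurable.
pose N : {mfun (measurableTypeR R) >-> (measurableTypeR R)} :=
  HB.pack (-%R : R -> R)
    (isMeasurableFun.Build _ _ _ _ (-%R : measurableTypeR R -> measurableTypeR R) mN).
rewrite /normal_prob.
transitivity (\int[pushforward (@lebesgue_measure R) N]_(x in A) (normal_pdf 0 s x)%:E)%E.
  rewrite ge0_integral_pushforward//; last 2 first.
  - apply/measurable_EFinP; apply: measurable_funTS; exact: measurable_normal_pdf.
  - by move=> x _; rewrite lee_fin normal_pdf_ge0.
  apply: eq_integral => x _ /=; congr EFin.
  by rewrite !normal_pdfE// /normal_fun !subr0 sqrrN.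
by apply: eq_measure_integral => B mB _; exact: lebesgue_measure_opp.
Qed.

Lemma symmetric_law_normal (X : {RV P >-> R}) (s : R) : s != 0 ->
  distribution P X = normal_prob 0 s -> symmetric_law X.
Proof.
move=> s0 Xs A mA; rewrite -[LHS]/(distribution P X A).
rewrite -[RHS]/(distribution P X (-%R @^-1` A)) Xs normal_prob_opp//.
Qed.

(** By independence the joint laws of (X, Y) and (-X, -Y) agree on rectangles, hence everywhere, in
    particular on preimages under addition. *)
Lemma symmetric_lawD X Y : measurable_fun setT X -> measurable_fun setT Y ->
  (forall A B, measurable A -> measurable B ->
    P (X @^-1` A `&` Y @^-1` B) = (P (X @^-1` A) * P (Y @^-1` B))%E) ->
  symmetric_law X -> symmetric_law Y -> symmetric_law (X \+ Y).
Proof.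
move=> mX mY XY sX sY A mA.
have mN (Z : T -> R) : measurable_fun setT Z -> measurable_fun setT (\- Z).
  exact: measurable_funN.
pose Z w := (X w, Y w); pose Z' w := (- X w, - Y w).
have mZ : measurable_fun setT Z by exact: measurable_fun_pair.
have mZ' : measurable_fun setT Z' by apply: measurable_fun_pair; exact: mN.
pose mfZ : {mfun T >-> (R * R)%type} := HB.pack Z (isMeasurableFun.Build _ _ _ _ Z mZ).
pose mfZ' : {mfun T >-> (R * R)%type} := HB.pack Z' (isMeasurableFun.Build _ _ _ _ Z' mZ').
have mD : measurable_fun setT (fun p : R * R => p.1 + p.2).
  by apply: measurable_funD; [exact: measurable_fst|exact: measurable_snd].
have mC : measurable ((fun p : R * R => p.1 + p.2) @^-1` A).
  by rewrite -[X in measurable X]setTI; exact: mD.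
have oppA (B : set R) : measurable B -> measurable (-%R @^-1` B).
  by move=> mB; rewrite -[X in measurable X]setTI; exact: oppr_measurable.
transitivity (P (Z @^-1` ((fun p : R * R => p.1 + p.2) @^-1` A))); first by [].
transitivity (P (Z' @^-1` ((fun p : R * R => p.1 + p.2) @^-1` A))); last first.
  by congr (P _); apply/seteqP; split=> w /=; rewrite opprD.
apply: (@measure_eq_rectangles R _ _ R R (distribution P mfZ) (distribution P mfZ')) => //.
- move=> B1 B2 mB1 mB2.
  transitivity (P (X @^-1` B1 `&` Y @^-1` B2)); first by [].
  rewrite XY// sX// sY// -[(\- X) @^-1` B1]/(X @^-1` (-%R @^-1` B1)).
  by rewrite -[(\- Y) @^-1` B2]/(Y @^-1` (-%R @^-1` B2)) -XY//; exact: oppA.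
- by rewrite (le_lt_trans (probability_le1 (distribution P mfZ) _))// ltry.
Qed.

(** By symmetry F(g) = P(-V <= g) = P(V >= -g), so the claim reduces to the absence of an atom at
    -g. *)
Lemma prob_gt_symmetric (V : T -> R) (F : R -> R) (B K g : R) :
  measurable_fun setT V -> symmetric_law V ->
  (forall x, P [set w | V w <= x] = (F x)%:E) -> 0 < B -> 0 <= K ->
  (forall x y, - B <= x -> x <= y -> y <= B -> F y - F x <= K * (y - x)) ->
  `|g| <= B -> P [set w | 0 < g + V w] = (F g)%:E.
Proof.
move=> mV sV FV B0 K0 FK gB.
have mle x : measurable [set w | V w <= x].
  by rewrite -[X in measurable X]setTI; exact: measurable_fun_le.
have m1 x : measurable (V @^-1` [set x]).
  by rewrite -[X in measurable X]setTI; exact: mV.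
have atom v : - B < v -> v <= B -> P (V @^-1` [set v]) = 0%E.
  move=> Bv vB; pose p := fine (P (V @^-1` [set v])).
  have pE : P (V @^-1` [set v]) = p%:E by rewrite fineK// fin_num_measure.
  have p0 : 0 <= p by rewrite fine_ge0.
  rewrite pE; congr EFin; apply/eqP; rewrite eq_le p0 andbT leNgt; apply/negP => pp.
  (* An atom of mass p makes F jump by p at v. On a step e <= [e0] the Lipschitz bound allows less
     than p/2; the minimum with v + B keeps v - e inside [-B, B]. *)
  pose e0 := p / (2 * (K + 1)).
  have e0E : K * e0 + e0 = p / 2 by rewrite /e0; field; apply/eqP => ?; lra.
  have e00 : 0 < e0 by rewrite divr_gt0//; lra.
  pose e := Num.min (v + B) e0.
  have ev : e <= v + B by rewrite ge_min lexx.
  have ee0 : e <= e0 by rewrite ge_min lexx orbT.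
  have e_gt0 : 0 < e by rewrite lt_min e00 andbT; lra.
  have Ke : K * e <= K * e0 by rewrite ler_wpM2l.
  have : p + F (v - e) <= F v.
    rewrite -lee_fin EFinD -pE -!FV -measureU//.
      apply: le_measure; rewrite ?inE//; first exact: measurableU.
      by move=> w /= [->//|/le_trans]; apply; lra.
    apply/seteqP; split=> // w /= [->]; lra.
  have := FK (v - e) v; rewrite opprB addrCA subrr addr0 => /(_ _ _ vB) H.
  have {H} : F v - F (v - e) <= K * e by apply: H; lra.
  lra.
have atomN : P (V @^-1` [set - g]) = 0%E.
  move: gB; rewrite ler_norml => /andP[g1 g2].
  have [gl|] := ltP (- B) (- g); first by apply: atom; lra.
  (* Here g = B and the atom would sit at the left endpoint -B; symmetry moves it to B, where the
     step to the left is available. *)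
  move=> gl; rewrite sV// -[RHS](atom g); [|lra|lra].
  by congr (P _); apply/seteqP; split=> w /= /eqP; rewrite ?eqr_opp => /eqP->.
rewrite -FV.
have -> : P [set w | V w <= g] = P ((\- V) @^-1` `]-oo, g]).
  by rewrite -sV//; congr (P _); apply/seteqP; split=> w /=; rewrite in_itv.
have -> : (\- V) @^-1` `]-oo, g] = [set w | 0 < g + V w] `|` V @^-1` [set - g].
  apply/seteqP; split=> w /=; rewrite in_itv/=.
    move=> Vg; have [?|?|?] := ltgtP (- g) (V w); [left|left|right] => //; lra.
  by case=> [|->]; lra.
have mgt : measurable [set w | 0 < g + V w].
  suff -> : [set w | 0 < g + V w] = ~` [set w | V w <= - g] by exact: measurableC.
  by apply/seteqP; split=> w /= => [?|/negP]; [apply/negP|]; rewrite -?ltNge; lra.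
have dis : [set w | 0 < g + V w] `&` V @^-1` [set - g] = set0.
  by apply/seteqP; split=> // w /= [+ Vw]; rewrite Vw; lra.
rewrite measureU// -[LHS]adde0; congr (_ + _)%E; exact/esym/atomN.
Qed.

End Symmetry.

(** * From mutual independence to independence of pairs *)

Section Independence.
Context d (T : measurableType d) (R : realType) (P : probability T R).

(** With [E] fixed, both sides are finite measures in [C] that agree on rectangles. *)
Lemma independent_pair_event (X1 X2 : T -> R) (E : set T) :
  measurable_fun setT X1 -> measurable_fun setT X2 -> measurable E ->
  (forall A B, measurable A -> measurable B ->
    P (X1 @^-1` A `&` X2 @^-1` B `&` E) =
    (P (X1 @^-1` A `&` X2 @^-1` B) * P E)%E) ->
  forall C : set (R * R), measurable C ->
    P ((fun w => (X1 w, X2 w)) @^-1` C `&` E) =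
    (P ((fun w => (X1 w, X2 w)) @^-1` C) * P E)%E.
Proof.
move=> mX1 mX2 mE XE C mC; pose Z w := (X1 w, X2 w).
have mZ : measurable_fun setT Z by exact: measurable_fun_pair.
pose mfZ : {mfun T >-> (R * R)%type} := HB.pack Z (isMeasurableFun.Build _ _ _ _ Z mZ).
have p0 : 0 <= fine (P E) by rewrite fine_ge0.
have pE : (fine (P E))%:E = P E by rewrite fineK ?fin_num_measure.
rewrite muleC -pE.
apply: (@measure_eq_rectangles R _ _ R R (pushforward (mrestr P mE) mfZ)
  (mscale (NngNum p0) (distribution P mfZ))) => //.
- move=> A B mA mB; transitivity (P (X1 @^-1` A `&` X2 @^-1` B `&` E)); first by [].
  by rewrite XE// muleC -[X in (X * _)%E]pE.
- rewrite -[X in (X < _)%E]/(P (Z @^-1` setT `&` E)) preimage_setT setTI.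
  by rewrite (le_lt_trans (probability_le1 P mE))// ltry.
Qed.

Lemma independent_pairs (X1 X2 X3 X4 : T -> R) :
  measurable_fun setT X1 -> measurable_fun setT X2 ->
  measurable_fun setT X3 -> measurable_fun setT X4 ->
  (forall A1 A2 A3 A4, measurable A1 -> measurable A2 -> measurable A3 -> measurable A4 ->
    P (X1 @^-1` A1 `&` X2 @^-1` A2 `&` (X3 @^-1` A3 `&` X4 @^-1` A4)) =
    (P (X1 @^-1` A1) * P (X2 @^-1` A2) * (P (X3 @^-1` A3) * P (X4 @^-1` A4)))%E) ->
  forall C D : set (R * R), measurable C -> measurable D ->
    P ((fun w => (X1 w, X2 w)) @^-1` C `&` (fun w => (X3 w, X4 w)) @^-1` D) =
    (P ((fun w => (X1 w, X2 w)) @^-1` C) * P ((fun w => (X3 w, X4 w)) @^-1` D))%E.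
Proof.
move=> mX1 mX2 mX3 mX4 X4E C D mC mD.
have mpre (X : T -> R) A : measurable_fun setT X -> measurable A -> measurable (X @^-1` A).
  by move=> mX mA; rewrite -[X in measurable X]setTI; exact: mX.
have X12 A1 A2 : measurable A1 -> measurable A2 ->
    P (X1 @^-1` A1 `&` X2 @^-1` A2) = (P (X1 @^-1` A1) * P (X2 @^-1` A2))%E.
  move=> mA1 mA2; have := X4E A1 A2 setT setT mA1 mA2 measurableT measurableT.
  by rewrite !preimage_setT !setIT !probability_setT !mule1.
have X34 A1 A2 : measurable A1 -> measurable A2 ->
    P (X3 @^-1` A1 `&` X4 @^-1` A2) = (P (X3 @^-1` A1) * P (X4 @^-1` A2))%E.
  move=> mA1 mA2; have := X4E setT setT A1 A2 measurableT measurableT mA1 mA2.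
  by rewrite !preimage_setT !setTI !probability_setT !mul1e.
(* One pair at a time passes from rectangles to Borel sets: first (X3, X4) against the event given
   by C, then (X1, X2) against a rectangle event of (X3, X4). *)
rewrite setIC muleC.
apply: (independent_pair_event mX3 mX4) => //.
  have mZ : measurable_fun setT (fun w => (X1 w, X2 w)) by exact: measurable_fun_pair.
  by rewrite -[X in measurable X]setTI; exact: mZ.
move=> A3 A4 mA3 mA4; rewrite setIC muleC.
apply: (independent_pair_event mX1 mX2) => //.
  by apply: measurableI; exact: mpre.
by move=> A1 A2 mA1 mA2; rewrite X4E// X12// X34.
Qed.

(** Coordinates outside [s] receive the whole line, which contributes probability 1. *)
Lemma mutually_independent_seq (I : finType) (X : I -> T -> R) (B : I -> set R)
    (s : seq I) : mutually_independent P X -> uniq s ->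
  (forall i, measurable (B i)) ->
  P (\big[setI/setT]_(i <- s) (X i @^-1` B i)) =
  (\prod_(i <- s) P (X i @^-1` B i))%E.
Proof.
move=> indX us mB; pose B' i := if i \in s then B i else setT.
have := indX B'; rewrite -bigcap_seq.
have -> : \bigcap_(i in [set: I]) (X i @^-1` B' i) = \bigcap_(i in [set` s]) (X i @^-1` B i).
  apply/seteqP; split=> w /= h i; first by move=> si; have := h i Logic.I; rewrite /B' si.
  by move=> _; rewrite /B'; case: ifP => // si; exact: h.
move=> -> => [|i]; last by rewrite /B'; case: ifP.
rewrite [RHS]big_uniq// [RHS]big_mkcond/=; apply: eq_bigr => i _; rewrite /B'.
by case: ifP => // _; rewrite preimage_setT probability_setT.
Qed.

End Independence.

(** * Fixed-point error and mean square of the bits *)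

Section Contraction.
Context {R : realType}.
Implicit Types (M N : nat) (b : R).

(* Convexity of the square; stands in for the triangle inequality of the norm. *)
Lemma frob2D_le N b (x y : 'M[R[i]]_N) : 0 < b -> b < 1 ->
  frob2 (x + y) <= b^-1 * frob2 x + (1 - b)^-1 * frob2 y.
Proof.
move=> b0 b1; have c0 : 0 < 1 - b by rewrite subr_gt0.
have D2 (s t : R) : (s + t) ^+ 2 <= b^-1 * s ^+ 2 + (1 - b)^-1 * t ^+ 2.
  rewrite -subr_ge0 (_ : _ - _ = (b * (1 - b))^-1 * ((1 - b) * s - b * t) ^+ 2).
    by rewrite mulr_ge0 ?sqr_ge0// invr_ge0 mulr_ge0 ?ltW.
  by field; rewrite !gt_eqF.
rewrite /frob2 !mulr_sumr -big_split; apply: ler_sum => i _ /=.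
rewrite !mulr_sumr -big_split; apply: ler_sum => j _ /=; rewrite !mxE.
case: (x i j) (y i j) => [a c] [a' c'] /=.
have := D2 a a'; have := D2 c c'; rewrite !mulrDr; lra.
Qed.

(** [K / (1 - b)] is the fixed point of u = b u + K; the excess over it shrinks by the factor b at
    each step. *)
Lemma affine_recurrence_le b (K : R) (u : nat -> R) : 0 <= b -> b < 1 ->
  (forall n, u n.+1 <= b * u n + K) ->
  forall n, u n <= b ^+ n * (u 0 - K / (1 - b)) + K / (1 - b).
Proof.
move=> b0 b1 uK; elim=> [|n IH]; first by rewrite expr0 mul1r subrK.
apply: le_trans (uK n) _; apply: (le_trans (lerD (ler_wpM2l b0 IH) (lexx K))).
rewrite exprS le_eqVlt; apply/orP; left; apply/eqP; field.
by rewrite subr_eq0 gt_eqF.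
Qed.

(** Splitting G - x at [h n] with weight 1/2 costs the factor 2; the distance to G and the geometric
    term then vanish in the limit. *)
Lemma frob2_limit_le N b (D c : R) (h : nat -> 'M[R[i]]_N) (G x : 'M[R[i]]_N) :
  0 <= b -> b < 1 ->
  (fun n => frob2 (h n - G)) @ \oo --> (0 : R^o) ->
  (forall n, frob2 (h n - x) <= b ^+ n * c + D) ->
  frob2 (G - x) <= 2 * D.
Proof.
move=> b0 b1 hG hx.
have bound n : frob2 (G - x) <= 2 * frob2 (h n - G) + 2 * (b ^+ n * c + D).
  have half0 : 0 < 2^-1 :> R by rewrite invr_gt0.
  have half1 : 2^-1 < 1 :> R by lra.
  have := frob2D_le (G - h n) (h n - x) half0 half1.
  rewrite addrA subrK => /le_trans; apply.
  rewrite (_ : (1 - 2^-1)^-1 = 2 :> R); last by field.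
  rewrite invrK lerD//; last by rewrite ler_wpM2l.
  by rewrite -opprB -scaleN1r -(rmorphN1 (real_complex R)) frob2Z sqrrN expr1n mul1r.
have lim : (fun n => 2 * frob2 (h n - G) + 2 * (b ^+ n * c + D)) @ \oo -->
    (2 * 0 + 2 * (0 * c + D) : R).
  apply: cvgD; first by apply: cvgM; [exact: cvg_cst|exact: hG].
  apply: cvgM; first exact: cvg_cst.
  apply: cvgD; last exact: cvg_cst.
  apply: cvgM; last exact: cvg_cst.
  by apply: cvg_expr; rewrite ger0_norm.
apply/ler_addgt0Pr => e e0.
have : 2 * 0 + 2 * (0 * c + D) < 2 * D + e by lra.
move=> /(cvgr_lt _ lim) /filter_ex [n /ltW]; exact: le_trans.
Qed.

Context (M N : nat) (gamma alpha : R) (F : R -> R).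
Hypothesis F_inc : forall x y, in_range N x -> in_range N y -> x <= y ->
  (1 - alpha) * (y - x) <= gamma * (F y - F x) <= (1 + alpha) * (y - x).

Definition mx_in_range (h : 'M[R[i]]_N) := forall k l,
  in_range N (complex.Re (h k l)) /\ in_range N (complex.Im (h k l)).

(** [F_inc] is the integrated form of |1 - gamma f| <= alpha: for y <= x it places the difference
    between -alpha (x - y) and alpha (x - y). *)
Let shrink (x y : R) : in_range N x -> in_range N y ->
  ((x - y) - gamma * (F x - F y)) ^+ 2 <= alpha ^+ 2 * (x - y) ^+ 2.
Proof.
wlog xy : x y / y <= x => [wl rx ry|rx ry].
  have [/wl->//|/ltW/wl] := leP y x.
  by rewrite -[leLHS]sqrrN -[(y - x) ^+ 2]sqrrN => /(_ ry rx); congr (_ <= _); ring.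
have /andP[? ?] := F_inc ry rx xy.
rewrite -exprMn -[leLHS]real_normK ?num_real// -[leRHS]real_normK ?num_real//.
rewrite ler_sqr ?nnegrE ?normr_ge0//.
by rewrite (le_trans _ (ler_norm _))// ler_norml; apply/andP; split; lra.
Qed.

(** The samples cancel in the difference, so the same factor serves for every outcome. *)
Lemma Zop_contraction (XR XI : 'M[R]_N) (h h' : 'M[R[i]]_N) :
  mx_in_range h -> mx_in_range h' ->
  frob2 (Zop M gamma F XR XI h - Zop M gamma F XR XI h') <=
  alpha ^+ 2 * frob2 (h - h').
Proof.
move=> hr hr'; apply: le_trans (Qop_nonexpansive _ _ _) _.
rewrite /frob2 mulr_sumr; apply: ler_sum => k _.
rewrite mulr_sumr; apply: ler_sum => l _.
have [r1 r2] := hr k l; have [r1' r2'] := hr' k l.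
have := lerD (shrink r1 r1') (shrink r2 r2'); rewrite !mxE.
case: (h k l) (h' k l) => [a c] [a' c'] /=; rewrite -mulrDr; apply: le_trans.
rewrite le_eqVlt; apply/orP; left; apply/eqP; ring.
Qed.

Lemma Zop_in_range (XR XI : 'M[R]_N) h : mx_in_range (Zop M gamma F XR XI h).
Proof. by move=> k l; exact: Qop_in_range. Qed.

Lemma fixed_point_error (XR XI : 'M[R]_N) (gt G : 'M[R[i]]_N) :
  0 <= alpha -> alpha < 1 -> mx_in_range gt ->
  (fun n => frob2 (iter n (Zop M gamma F XR XI) 0 - G)) @ \oo --> (0 : R^o) ->
  frob2 (G - gt) <=
    8 / (1 - alpha) ^+ 2 * frob2 (Zop M gamma F XR XI gt - gt).
Proof.
move=> a0 a1 gtr hG; set Z := Zop M gamma F XR XI; set delta := frob2 (Z gt - gt).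
(* The midpoint is positive even if alpha = 0 and satisfies alpha^2 / b <= b < 1. Iteration gives
   delta / (1 - b)^2 = 4 delta / (1 - alpha)^2, doubled by the passage to the limit. *)
pose b := (1 + alpha) / 2.
have b0 : 0 < b by rewrite /b; lra.
have b1 : b < 1 by rewrite /b; lra.
have ab : alpha <= b by rewrite /b; lra.
have hr n : mx_in_range (iter n Z 0).
  case: n => [k l|n]; last exact: Zop_in_range.
  have : in_range N (0 : R) by rewrite /in_range oppr_le0 mulr_ge0 ?sqr_ge0.
  by rewrite !mxE.
have rec n : frob2 (iter n.+1 Z 0 - gt) <=
    b * frob2 (iter n Z 0 - gt) + (1 - b)^-1 * delta.
  rewrite iterS -[X in X - gt](subrK (Z gt)) -addrA.
  apply: le_trans (frob2D_le _ _ b0 b1) _; apply: lerD; last exact: lexx.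
  rewrite ler_pdivrMl//.
  apply: le_trans (Zop_contraction _ _ (hr n) gtr) _.
  by rewrite mulrA ler_wpM2r ?frob2_ge0// -expr2 ler_sqr ?nnegrE// ltW.
have := affine_recurrence_le (ltW b0) b1 rec.
move/(frob2_limit_le (ltW b0) b1 hG) => /le_trans; apply.
rewrite le_eqVlt; apply/orP; left; apply/eqP; rewrite /b; field.
by apply/eqP; lra.
Qed.

End Contraction.

(** * The one-step residual as a linear combination of centred bits *)

Section SampleNoise.
Context {R : realType}.

Definition cplx_part (b : bool) (z : R[i]) : R :=
  if b then complex.Im z else complex.Re z.

(* An index (b, k, l) stands for the real (b = false) or imaginary (b = true) part
   of the frequency (k, l). *)
Definition idft_coef N (m : 'I_N * 'I_N) (p : bool * 'I_N * 'I_N) : R :=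
  let t := 2 * pi * (m.1 * p.1.2 + m.2 * p.2)%:R / N%:R in
  if p.1.1 then - sin t else cos t.

Lemma idft_coef_le1 N m p : `|@idft_coef N m p| <= 1.
Proof.
by rewrite /idft_coef; case: ifP => _; rewrite ?normrN ler_norml
  ?cos_geN1 ?cos_le1 ?sin_geN1 ?sin_le1.
Qed.

(** Clipping sees only real parts, and Re(z e^(jt)) = cos t Re z - sin t Im z: a pixel becomes a
    real combination of 2N^2 real quantities. *)
Lemma Re_idft2 N (x : 'M[R[i]]_N) (i j : 'I_N) :
  complex.Re (idft2 x i j) = (N%:R ^+ 2)^-1 *
    \sum_p idft_coef (i, j) p * cplx_part p.1.1 (x p.1.2 p.2).
Proof.
rewrite mxE -(pair_bigA _ (fun q l => idft_coef (i, j) (q, l) * cplx_part q.1 (x q.2 l))) /=.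
rewrite -(pair_bigA _ (fun b k => \sum_l idft_coef (i, j) (b, k, l) * cplx_part b (x k l))) /=.
have ReZ (a : R) (z : R[i]) : complex.Re (a%:C * z) = a * complex.Re z.
  by case: z => a' b'; rewrite /= mul0r subr0.
rewrite ReZ; congr (_ * _).
rewrite big_bool -big_split /= raddf_sum.
apply: eq_bigr => k _; rewrite raddf_sum -big_split; apply: eq_bigr => l _ /=.
by case: (x k l) => a c /=; rewrite /idft_coef /=; ring.
Qed.

(** The factor gamma^2 / N^2 is Parseval's N^2 times the square of gamma / N^2, the step size with
    the normalisation of the inverse transform. *)
Lemma frob2_Zop_sub N M (gamma : R) (F : R -> R) (XR XI : 'M[R]_N) (gt : 'M[R[i]]_N) :
  Qop M gt = gt ->
  frob2 (Zop M gamma F XR XI gt - gt) <=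
  gamma ^+ 2 / N%:R ^+ 2 * \sum_(m : 'I_N * 'I_N | in_block M m.1 m.2)
    (\sum_p idft_coef m p *
      ((if p.1.1 then XI else XR) p.1.2 p.2 + 2^-1
        - F (cplx_part p.1.1 (gt p.1.2 p.2)))) ^+ 2.
Proof.
move=> Qgt; rewrite -{2}Qgt; apply: le_trans (frob2_Qop _ _ _) _.
rewrite pair_big_dep /= !mulr_sumr; apply: ler_sum => -[i j] /= _.
rewrite Re_idft2.
rewrite (eq_bigr (fun p => gamma * (idft_coef (i, j) p *
      ((if p.1.1 then XI else XR) p.1.2 p.2 + 2^-1
        - F (cplx_part p.1.1 (gt p.1.2 p.2)))))) => [|[[b k] l] _]; last first.
  rewrite !mxE /= /cplx_part; case: (gt k l) => a c.
  have -> : (1 +i* 1) / 2 = 2^-1 +i* 2^-1 :> R[i].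
    apply: (mulIf (_ : 2 != 0)) => //; rewrite mulfVK// -(rmorph_nat (real_complex R) 2) /=.
    by simpc; rewrite mulVf.
  by case: b => /=; ring.
rewrite -mulr_sumr; set S := \sum_p _.
have : N%:R != 0 :> R.
  by rewrite pnatr_eq0 -lt0n (leq_ltn_trans (leq0n i) (ltn_ord i)).
move: (N%:R) S => n S n0; rewrite le_eqVlt; apply/orP; left; apply/eqP.
by field.
Qed.

Lemma card_in_block N M : (M <= N)%N ->
  #|[pred m : 'I_N * 'I_N | in_block M m.1 m.2]| = (M * M)%N.
Proof.
move=> MN; have -> : #|[pred m : 'I_N * 'I_N | in_block M m.1 m.2]| =
    #|[predX [pred i : 'I_N | (i < M)%N] & [pred i : 'I_N | (i < M)%N]]|.
  by apply: eq_card => m; rewrite !inE.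
rewrite cardX; suff -> : #|[pred i : 'I_N | (i < M)%N]| = M by [].
by rewrite -sum1_card (big_ord_narrow MN) /= sum_nat_const card_ord muln1.
Qed.

End SampleNoise.

(** * Independence and mean square of the noisy bits *)

Section NoisyBits.
Context d (T : measurableType d) (R : realType) (P : probability T R).

Lemma expectation_sum_sqr_le (J : finType) (Q : pred J) (S : J -> T -> R) (k b : R) :
  0 <= k -> (forall j, measurable_fun setT (S j)) ->
  (forall j, (\int[P]_w ((S j w) ^+ 2)%:E <= b%:E)%E) ->
  (\int[P]_w (k * \sum_(j | Q j) S j w ^+ 2)%:E <= (k * (b * #|Q|%:R))%:E)%E.
Proof.
move=> k0 mS Sb.
have mS2 j : measurable_fun setT (fun w => S j w ^+ 2) by exact: measurable_funX.
under eq_integral do rewrite EFinM -sumEFin -big_enum.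
rewrite ge0_integralZl_EFin//; last 2 first.
- by move=> w _; apply: sume_ge0 => j _; rewrite lee_fin sqr_ge0.
- by apply: emeasurable_sum => j; apply/measurable_EFinP.
rewrite EFinM lee_wpmul2l ?lee_fin// ge0_integral_sum//; last 2 first.
- by move=> j; apply/measurable_EFinP.
- by move=> j w _; rewrite lee_fin sqr_ge0.
rewrite big_enum /= (le_trans (lee_sum _ (fun j _ => Sb j)))//.
by rewrite sumEFin sumr_const mulr_natr.
Qed.

(** [e false p] and [e true p] index the two noises added at p. For p != q the four indices are
    distinct, so the pairs are independent, and so are their sums. *)
Lemma independent_sums (I K : finType) (X : I -> T -> R) (e : bool -> K -> I) :
  mutually_independent P X -> (forall i, measurable_fun setT (X i)) ->
  (forall b p b' q, e b p = e b' q -> b = b' /\ p = q) ->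
  forall p q, p != q -> forall C D : set R, measurable C -> measurable D ->
  P ((X (e false p) \+ X (e true p))%R @^-1` C `&`
     (X (e false q) \+ X (e true q))%R @^-1` D) =
  (P ((X (e false p) \+ X (e true p))%R @^-1` C) *
   P ((X (e false q) \+ X (e true q))%R @^-1` D))%E.
Proof.
move=> indX mX e_inj p q pq C D mC mD.
have e_neq b a b' a' : (b, a) != (b', a') -> (e b a == e b' a') = false.
  by move=> ne; apply/eqP => /e_inj[eb ea]; rewrite eb ea eqxx in ne.
have mD2 : measurable_fun setT (fun p : R * R => p.1 + p.2).
  by apply: measurable_funD; [exact: measurable_fst|exact: measurable_snd].
have msum (A : set R) : measurable A -> measurable ((fun p : R * R => p.1 + p.2) @^-1` A).
  by move=> mA; rewrite -[X in measurable X]setTI; exact: mD2.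
apply: (independent_pairs (mX (e false p)) (mX (e true p)) (mX (e false q)) (mX (e true q))
  _ (msum C mC) (msum D mD)) => A1 A2 A3 A4 mA1 mA2 mA3 mA4.
pose B i := if i == e false p then A1 else if i == e true p then A2
            else if i == e false q then A3 else A4.
have qp : q != p by rewrite eq_sym.
pose s := [:: e false p; e true p; e false q; e true q].
(* All six disequalities in both orientations, so that one rewrite decides every test in [uniq] and
   in [B]. *)
have neE := (e_neq false p true p, e_neq false p false q, e_neq false p true q,
  e_neq true p false q, e_neq true p true q, e_neq false q true q,
  e_neq true p false p, e_neq false q false p, e_neq true q false p,
  e_neq false q true p, e_neq true q true p, e_neq true q false q).
have us : uniq s by rewrite /= !inE !neE// xpair_eqE ?negb_and ?pq ?qp ?orbT.
have mB i : measurable (B i) by rewrite /B; do !case: ifP.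
have := mutually_independent_seq indX us mB.
rewrite !big_cons !big_nil setIT mule1 /B !eqxx !neE;
  try by rewrite xpair_eqE ?negb_and ?pq ?qp ?orbT.
by rewrite setIA muleA => ->; rewrite !muleA.
Qed.

Lemma independent_two (I : finType) (X : I -> T -> R) (i j : I) :
  mutually_independent P X -> i != j ->
  forall A B, measurable A -> measurable B ->
  P (X i @^-1` A `&` X j @^-1` B) = (P (X i @^-1` A) * P (X j @^-1` B))%E.
Proof.
move=> indX ij A B mA mB; pose C k := if k == i then A else B.
have us : uniq [:: i; j] by rewrite /= inE ij.
have mC k : measurable (C k) by rewrite /C; case: ifP.
have := mutually_independent_seq indX us mC.
by rewrite !big_cons !big_nil setIT mule1 /C eqxx eq_sym (negbTE ij).
Qed.

(** Adding 1/2 turns a bit into the indicator of V > -v, so independence of the noises passes to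
    these events; subtracting their probability F(v) centres them. *)
Lemma bits_mean_square (K J : finType) (Q : pred J) (V : K -> T -> R)
    (F : R -> R) (v : K -> R) (c : J -> K -> R) (k : R) :
  0 <= k -> (forall j p, `|c j p| <= 1) -> (forall p, measurable_fun setT (V p)) ->
  (forall p, P [set w | 0 < v p + V p w] = (F (v p))%:E) ->
  (forall p q, p != q -> forall C D : set R, measurable C -> measurable D ->
    P (V p @^-1` C `&` V q @^-1` D) = (P (V p @^-1` C) * P (V q @^-1` D))%E) ->
  (\int[P]_w (k * \sum_(j | Q j) (\sum_p c j p *
      (sgn_bit (v p + V p w) + 2^-1 - F (v p))) ^+ 2)%:E
    <= (k * (#|K|%:R * #|Q|%:R))%:E)%E.
Proof.
move=> k0 c1 mV PV indV.
pose A p : set T := V p @^-1` `]- v p, +oo[.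
have AE p : A p = [set w | 0 < v p + V p w].
  by apply/seteqP; split=> w; rewrite /A /= in_itv/= andbT; lra.
have mA p : measurable (A p) by rewrite -[X in measurable X]setTI; exact: mV.
have PA p : P (A p) = (F (v p))%:E by rewrite AE.
pose Y p w : R := \1_(A p) w - F (v p).
have YE p w : sgn_bit (v p + V p w) + 2^-1 - F (v p) = Y p w.
  rewrite /Y indicE /sgn_bit subrK AE; congr (_ - _).
  by case: ifPn => h; [rewrite mem_set|rewrite memNset//=; exact/negP].
have mY p : measurable_fun setT (Y p) by exact: measurable_funB.
have Y1 p w : `|Y p w| <= 1.
  have F0 : 0 <= F (v p) by rewrite -lee_fin -PA.
  have F1 : F (v p) <= 1 by rewrite -lee_fin -PA probability_le1.
  by rewrite /Y indicE ler_norml; case: (_ \in _) => /=; apply/andP; split; lra.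
under eq_integral do under eq_bigr do under eq_bigr do rewrite YE.
apply: expectation_sum_sqr_le => // j.
  by apply: measurable_sum => p; exact: measurable_funM.
apply: expectation_sqr_sum_uncorrelated => // p q pq.
by apply: expectation_indic_centered => //; exact: indV.
Qed.

End NoisyBits.

Unset Implicit Arguments.
Set Strict Implicit.

Theorem theorem2 (R : realType) :
  exists C : R -> R -> R,
  forall (M N : nat) (g : 'M[R]_N)
    (d : measure_display) (T : measurableType d) (P : probability T R)
    (WR WI dR dI : 'I_N -> 'I_N -> {RV P >-> R}) (sigma : R)
    (F f : R -> R) (fmax gamma alpha : R) (G : T -> 'M[R[i]]_N),
  (* image size and zero padding: N > 2M, grey values in [0,255] on the
     M x M block, zero elsewhere *)
  (0 < M)%N -> (2 * M < N)%N ->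
  (forall i j : 'I_N, in_block M i j -> 0 <= g i j <= 255) ->
  (forall i j : 'I_N, ~~ in_block M i j -> g i j = 0) ->
  (* noise model: all entries of W_R, W_I, d_R, d_I mutually independent *)
  mutually_independent P (noise_family (fun k l => (WR k l : T -> R))
     (fun k l => (WI k l : T -> R)) (fun k l => (dR k l : T -> R))
     (fun k l => (dI k l : T -> R))) ->
  (* W: zero mean, symmetric about 0 *)
  (forall k l, (WR k l : T -> R) \in Lfun P 1%E /\ ('E_P[WR k l] = 0)%E) ->
  (forall k l, (WI k l : T -> R) \in Lfun P 1%E /\ ('E_P[WI k l] = 0)%E) ->
  (forall k l x, P [set w | WR k l w <= x] = P [set w | - WR k l w <= x]) ->
  (forall k l x, P [set w | WI k l w <= x] = P [set w | - WI k l w <= x]) ->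
  (* d: AWGN dither N(0, sigma^2), or no dither at all *)
  ((forall k l w, dR k l w = 0 /\ dI k l w = 0) \/
   (0 < sigma /\ forall k l, distribution P (dR k l) = normal_prob 0 sigma
                          /\ distribution P (dI k l) = normal_prob 0 sigma)) ->
  (* F is the CDF and f the PDF of the total noise W + d *)
  (forall k l x, P [set w | WR k l w + dR k l w <= x] = (F x)%:E) ->
  (forall k l x, P [set w | WI k l w + dI k l w <= x] = (F x)%:E) ->
  (forall x, 0 <= f x) ->
  (forall x, (F x)%:E = (\int[lebesgue_measure]_(t in `]-oo, x]) (f t)%:E)%E) ->
  (* the total noise density is positive on the signal range *)
  (forall x, in_range N x -> 0 < f x) ->
  (* f_max = max of f over the signal range *)
  (forall x, in_range N x -> f x <= fmax) ->
  (exists2 x, in_range N x & f x = fmax) ->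
  (* step size gamma in (0, 2/f_max) *)
  0 < gamma -> gamma < 2 / fmax ->
  (* alpha = || 1 - gamma f ||_max over the signal range *)
  (forall x, in_range N x -> `|1 - gamma * f x| <= alpha) ->
  (exists2 x, in_range N x & `|1 - gamma * f x| = alpha) ->
  let gt := dft2 (map_mx (fun t : R => t%:C) g) in
  let XR := fun w => \matrix_(k, l) sgn_bit (complex.Re (gt k l) + WR k l w + dR k l w) in
  let XI := fun w => \matrix_(k, l) sgn_bit (complex.Im (gt k l) + WI k l w + dI k l w) in
  (* G(w) is the fixed point reached by G^(0) = 0, G^(k+1) = Z(G^(k)) *)
  (forall w, (fun n : nat => frob2 (iter n (Zop M gamma F (XR w) (XI w)) 0 - G w))
               @ \oo --> (0 : R^o)) ->
  (((N%:R ^+ 2)^-1)%:E * 'E_P[fun w => frob2 (G w - gt)]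
    <= (C gamma alpha * (M%:R ^+ 2 / N%:R ^+ 2))%:E)%E.
Proof.
(* 16 = 8 * 2: the 8 of [fixed_point_error] and the 2 in the count 2N^2 of real bits. *)
exists (fun gamma alpha => 16 * gamma ^+ 2 / (1 - alpha) ^+ 2).
move=> M N g d T P WR WI dR dI sigma F f fmax gamma alpha G M0 MN g255 g0 indep.
move=> _ _ symWR symWI dither FR FI f0 Fint fpos fmax_ub [xm xm_range fxm].
move=> gamma0 gamma_lt alpha_ub [xa xa_range alphaE] gt XR XI Glim.
have N0 : (0 < N)%N by exact: leq_ltn_trans MN.
have NR0 : 0 < N%:R :> R by rewrite ltr0n.
pose B : R := 255 * N%:R ^+ 2.
have B0 : 0 < B by rewrite mulr_gt0 ?exprn_gt0.
have fmax0 : 0 < fmax by rewrite -fxm fpos.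
have gf2 : gamma * fmax < 2 by rewrite -ltr_pdivlMr.
have alpha0 : 0 <= alpha by rewrite -alphaE.
(* The maximum is attained at [xa], where 0 < gamma f < 2, so the strict pointwise bound passes to
   alpha. *)
have alpha1 : alpha < 1.
  have h1 : 0 < gamma * f xa by rewrite mulr_gt0 ?fpos.
  have h2 : gamma * f xa <= gamma * fmax by rewrite ler_wpM2l ?fmax_ub ?(ltW gamma0).
  by rewrite -alphaE ltr_norml; apply/andP; split; lra.
have range_itv (x y t : R) : in_range N x -> in_range N y -> x < t <= y -> in_range N t.
  by rewrite /in_range => /andP[? ?] /andP[? ?] /andP[? ?]; apply/andP; split; lra.
have F_inc (x y : R) : in_range N x -> in_range N y -> x <= y ->
    (1 - alpha) * (y - x) <= gamma * (F y - F x) <= (1 + alpha) * (y - x).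
  move=> rx ry xy.
  have ft t : x < t <= y -> (1 - alpha) / gamma <= f t <= (1 + alpha) / gamma.
    move=> /(range_itv _ _ _ rx ry)/alpha_ub; rewrite ler_norml => /andP[? ?].
    by rewrite ler_pdivrMr// ler_pdivlMr// mulrC; apply/andP; split; lra.
  have lo0 : 0 <= (1 - alpha) / gamma by rewrite divr_ge0 ?(ltW gamma0)//; lra.
  have hi0 : 0 <= (1 + alpha) / gamma by rewrite divr_ge0 ?(ltW gamma0)//; lra.
  have lo := cdf_increment_ge f0 Fint xy lo0 (fun t h => proj1 (andP (ft t h))).
  have hi := cdf_increment_le f0 Fint xy hi0 (fun t h => proj2 (andP (ft t h))).
  move: lo hi; rewrite [gamma * _]mulrC ![_ / gamma * _]mulrAC.
  by rewrite ler_pdivrMr// ler_pdivlMr// => -> ->.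
have gt_range : mx_in_range gt.
  move=> k l; apply: dft2_in_range => i j.
  by have [/g255//|/g0->] := boolP (in_block M i j); rewrite lexx ler0n.
have Qgt : Qop M gt = gt by exact: Qop_dft2_id.
(* In the index of [noise_family] the first flag separates W from the dither, the second the real
   from the imaginary part; [e] prepends the first to a coefficient index p. *)
pose e (c : bool) (p : bool * 'I_N * 'I_N) := (c, p.1.1, p.1.2, p.2).
pose X : bool * bool * 'I_N * 'I_N -> T -> R :=
  noise_family (fun k l => (WR k l : T -> R)) (fun k l => (WI k l : T -> R))
    (fun k l => (dR k l : T -> R)) (fun k l => (dI k l : T -> R)).
have mX i : measurable_fun setT (X i).
  by case: i => [[[[] []] k] l] /=; exact: measurable_funPT.
have e_inj b p b' q : e b p = e b' q -> b = b' /\ p = q.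
  by case: p q => [[c k] l] [[c' k'] l'] [-> -> -> ->].
pose V p := X (e false p) \+ X (e true p).
pose v (p : bool * 'I_N * 'I_N) := cplx_part p.1.1 (gt p.1.2 p.2).
have mV p : measurable_fun setT (V p) by exact: measurable_funD.
have v_range p : in_range N (v p).
  by rewrite /v /cplx_part; have [] := gt_range p.1.2 p.2; case: ifP.
have FV p x : P [set w | V p w <= x] = (F x)%:E.
  by case: p => [[[] k] l]; [exact: FI|exact: FR].
have symV p : symmetric_law P (V p).
  apply: symmetric_lawD => //.
  - by apply: independent_two indep _; rewrite /e !xpair_eqE.
  - apply: symmetric_law_cdf => // x.
    by case: p => [[[] k] l]; [exact: symWI|exact: symWR].
  - case: dither => [d0|[s0 dN]].
      have -> : X (e true p) = cst 0.
        by apply/funext => w; case: p => [[[] k] l]; have [] := d0 k l w.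
      by move=> A mA; congr (P _); apply/seteqP; split=> w /=; rewrite oppr0.
    case: p => [[b k] l]; have [dRN dIN] := dN k l.
    by case: b; apply: (@symmetric_law_normal _ _ _ _ _ sigma) => //; rewrite gt_eqF.
have PV p : P [set w | 0 < v p + V p w] = (F (v p))%:E.
  apply: (@prob_gt_symmetric _ _ _ _ _ F B fmax) => //; first exact: ltW.
  - move=> x y Bx xy yB; apply: (cdf_increment_le f0 Fint) => //; first exact: ltW.
    move=> t /andP[xt ty]; apply: fmax_ub; rewrite /in_range -/B.
    by apply/andP; split; lra.
  - by rewrite ler_norml; exact: v_range.
have indV p q : p != q -> forall C D : set R, measurable C -> measurable D ->
    P (V p @^-1` C `&` V q @^-1` D) = (P (V p @^-1` C) * P (V q @^-1` D))%E.
  exact: independent_sums.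
pose kappa := 8 / (1 - alpha) ^+ 2 * (gamma ^+ 2 / N%:R ^+ 2).
have kappa0 : 0 <= kappa by rewrite mulr_ge0 ?divr_ge0 ?sqr_ge0.
have Gbound w : frob2 (G w - gt) <= kappa *
    \sum_(m : 'I_N * 'I_N | in_block M m.1 m.2)
      (\sum_p idft_coef m p * (sgn_bit (v p + V p w) + 2^-1 - F (v p))) ^+ 2.
  apply: le_trans (fixed_point_error F_inc alpha0 alpha1 gt_range (Glim w)) _.
  rewrite /kappa -[leRHS]mulrA ler_wpM2l ?divr_ge0 ?sqr_ge0//.
  apply: le_trans (frob2_Zop_sub _ _ _ _ Qgt) _.
  rewrite le_eqVlt; apply/orP; left; apply/eqP; congr (_ * _).
  apply: eq_bigr => m _; congr (_ ^+ 2); apply: eq_bigr => -[[b k] l] _.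
  by congr (_ * (_ + _ - _)); case: b => /=; rewrite [LHS]mxE -addrA.
have mse := bits_mean_square [pred m : 'I_N * 'I_N | in_block M m.1 m.2] kappa0
  (@idft_coef_le1 R N) mV PV indV.
rewrite expectation.unlock.
apply: (@le_trans _ _ (((N%:R ^+ 2)^-1)%:E * (kappa *
    (#|{: bool * 'I_N * 'I_N}|%:R * #|[pred m : 'I_N * 'I_N | in_block M m.1 m.2]|%:R))%:E)%E).
  rewrite lee_wpmul2l ?lee_fin ?invr_ge0 ?sqr_ge0//.
  apply: le_trans mse.
  by apply: le_integral_nonmeasurable => // w; exact: frob2_ge0.
rewrite card_in_block; last by rewrite (leq_trans _ (ltnW MN))// leq_pmull.
rewrite -EFinM lee_fin !card_prod card_bool card_ord !natrM /kappa.
have a1 : 1 - alpha != 0 by rewrite subr_eq0 gt_eqF.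
have n0 : N%:R != 0 :> R by rewrite gt_eqF.
rewrite le_eqVlt; apply/orP; left; apply/eqP; field.
by rewrite a1 n0.
Qed.
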